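(* Let $\rho\neq0$ be any step-size and set $\bm{\zeta}^0=\bm{0}$. Then the ADMM iterates satisfy, for all $k=0,1,2,\dots$: (i) If $\Vert\mathcal{A}\bm{x}^\star\Vert\neq0$ and $\Vert\bm{\lambda}^\star\Vert=0$, then $$\Vert\mathcal{A}\bm{x}^{k+2}-\mathcal{A}\bm{x}^{k+1}\Vert^2\le\frac{1}{k+1}\Vert\mathcal{A}\bm{x}^\star\Vert^2,\quad \Vert\bm{\lambda}^{k+1}-\bm{\lambda}^k\Vert^2\le\frac{1}{k+1}\Vert\mathcal{A}\bm{x}^\star\Vert^2\rho^4,\quad \Vert\bm{\zeta}^{k+1}-\bm{\zeta}^k\Vert^2\le\frac{1}{k+1}\Vert\mathcal{A}\bm{x}^\star\Vert^2\rho^2 .$$ (ii) If $\Vert\mathcal{A}\bm{x}^\star\Vert=0$ and $\Vert\bm{\lambda}^\star\Vert\neq0$, then $$\Vert\bm{\lambda}^{k+1}-\bm{\lambda}^k\Vert^2\le\frac{1}{k+1}\Vert\bm{\lambda}^\star\Vert^2,\quad \Vert\mathcal{A}\bm{x}^{k+2}-\mathcal{A}\bm{x}^{k+1}\Vert^2\le\frac{1}{k+1}\Vert\bm{\lambda}^\star\Vert^2\frac{1}{\rho^4},\quad \Vert\bm{\zeta}^{k+1}-\bm{\zeta}^k\Vert^2\le\frac{1}{k+1}\Vert\bm{\lambda}^\star\Vert^2\frac{1}{\rho^2}.$$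
   Context: $\mathbb{H},\mathbb{P},\mathbb{K}$ are real Hilbert spaces; $\Gamma_0(\cdot)$ denotes convex, closed, proper functions with values in $(-\infty,+\infty]$. Consider: minimize $f(\bm{x})+g(\bm{z})$ subject to $\mathcal{A}\bm{x}-\mathcal{B}\bm{z}=\bm{c}$, with $f\in\Gamma_0(\mathbb{H})$, $g\in\Gamma_0(\mathbb{P})$, $\bm{c}\in\mathbb{K}$, and $\mathcal{A}:\mathbb{H}\to\mathbb{K}$, $\mathcal{B}:\mathbb{P}\to\mathbb{K}$ injective bounded linear. A solution is assumed to exist: $\bm{x}^\star,\bm{z}^\star$ are optimal and $\bm{\lambda}^\star\in\mathbb{K}$ is an optimal Lagrange multiplier (i.e. $(\bm{x}^\star,\bm{z}^\star,\bm{\lambda}^\star)$ is a saddle point of $f(\bm{x})+g(\bm{z})+\langle\bm{\lambda},\mathcal{A}\bm{x}-\mathcal{B}\bm{z}-\bm{c}\rangle$). For a fixed domain step-size $\rho\neq0$ (classical step-size $\gamma=\rho^2$), ADMM iterates, for $k=0,1,\dots$: $$\bm{x}^{k+1}=\mathrm{argmin}_{\bm{x}}\,f(\bm{x})+\tfrac12\Vert\rho(\mathcal{A}\bm{x}-\mathcal{B}\bm{z}^k-\bm{c})+\bm{\lambda}^k/\rho\Vert^2,$$ $$\bm{z}^{k+1}=\mathrm{argmin}_{\bm{z}}\,g(\bm{z})+\tfrac12\Vert\rho(\mathcal{A}\bm{x}^{k+1}-\mathcal{B}\bm{z}-\bm{c})+\bm{\lambda}^k/\rho\Vert^2,$$ $$\bm{\lambda}^{k+1}=\bm{\lambda}^k+\rho^2(\mathcal{A}\bm{x}^{k+1}-\mathcal{B}\bm{z}^{k+1}-\bm{c}).$$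 All minimizers are understood to exist. The fixed-point variable is $\bm{\zeta}^{k+1}=\rho\mathcal{A}\bm{x}^{k+1}+\bm{\lambda}^k/\rho$, and the iteration is a fixed-point iteration in $\bm{\zeta}$. Initializing at $\bm{\zeta}^0\in\mathbb{K}$ means $\bm{z}^0=\mathrm{argmin}_{\bm{z}}\,g(\bm{z})+\frac12\Vert\rho\mathcal{B}\bm{z}+\rho\bm{c}-\bm{\zeta}^0\Vert^2$ and $\bm{\lambda}^0=\rho\bm{\zeta}^0-\rho^2(\mathcal{B}\bm{z}^0+\bm{c})$, the same relations that hold between $\bm{\zeta}^k$ and $(\bm{z}^k,\bm{\lambda}^k)$ for every $k\ge1$. *)

(* Defs.v *)
From HB Require Import structures.
From mathcomp Require Import all_boot all_order all_algebra.
From mathcomp Require Import sesquilinear.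
From mathcomp Require Import all_classical all_reals all_analysis.

Set Implicit Arguments.
Unset Strict Implicit.
Unset Printing Implicit Defensive.

Import Order.TTheory GRing.Theory Num.Theory.
Import numFieldNormedType.Exports.

Local Open Scope classical_set_scope.
Local Open Scope ring_scope.

HB.mixin Record CompleteNormedModule_isHilbert (R : realType) H
    of CompleteNormedModule R H := {
  inner : {dot H for (@idfun R)};
  sqr_norm_inner : forall x : H, `|x| ^+ 2 = inner x x
}.

#[short(type="hilbertType")]
HB.structure Definition Hilbert (R : realType) :=
  { H of CompleteNormedModule_isHilbert R H & CompleteNormedModule R H }.

Section ConvexAnalysis.
Variables (R : realType) (H : hilbertType R).
Implicit Type f : H -> \bar R.

Definition convex_efun f := forall (t : R) (x y : H), 0 < t < 1 ->
  (f (t *: x + (1 - t) *: y)%R <= t%:E * f x + (1 - t)%:E * f y)%E.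

Definition proper_efun f :=
  (forall x, f x != -oo%E) /\ (exists x, f x != +oo%E).

(* the class \Gamma_0(H); for functions on H, closed (i.e., closed epigraph)
   means lower semicontinuous *)
Definition Gamma0 f :=
  [/\ convex_efun f, lower_semicontinuous f & proper_efun f].

Definition argmin f : set H := [set x | forall y, (f x <= f y)%E].

End ConvexAnalysis.

Section ADMM.
Variables (R : realType) (H P K : hilbertType R).
Variables (f : H -> \bar R) (g : P -> \bar R).
Variables (A : {linear H -> K}) (B : {linear P -> K}) (c : K).

Definition optimal_solution (x : H) (z : P) :=
  A x - B z = c /\
  forall x' z', A x' - B z' = c -> (f x + g z <= f x' + g z')%E.

Definition lagrangian (x : H) (z : P) (lam : K) : \bar R :=
  (f x + g z + (inner lam (A x - B z - c)%R)%:E)%E.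

Definition saddle_point (xs : H) (zs : P) (ls : K) :=
  forall x z lam, (lagrangian xs zs lam <= lagrangian xs zs ls)%E /\
                  (lagrangian xs zs ls <= lagrangian x z ls)%E.

(* The term [x 0] is not constrained: the x-iterates start at [x 1]. *)
Record admm_iterates (rho : R) (zeta0 : K)
    (x : nat -> H) (z : nat -> P) (lam zeta : nat -> K) : Prop := {
  admm_zeta0 : zeta 0%N = zeta0;
  admm_z0 : argmin (fun z' : P => g z' +
    (2^-1 * `|rho *: B z' + rho *: c - zeta0| ^+ 2)%:E)%E (z 0%N);
  admm_lam0 : lam 0%N = rho *: zeta0 - rho ^+ 2 *: (B (z 0%N) + c);
  admm_xS : forall k, argmin (fun x' : H => f x' +
    (2^-1 * `|rho *: (A x' - B (z k) - c) + rho^-1 *: lam k| ^+ 2)%:E)%E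
    (x k.+1);
  admm_zS : forall k, argmin (fun z' : P => g z' +
    (2^-1 * `|rho *: (A (x k.+1) - B z' - c) + rho^-1 *: lam k| ^+ 2)%:E)%E
    (z k.+1);
  admm_lamS : forall k,
    lam k.+1 = lam k + rho ^+ 2 *: (A (x k.+1) - B (z k.+1) - c);
  admm_zetaS : forall k,
    zeta k.+1 = rho *: A (x k.+1) + rho^-1 *: lam k
}.

End ADMM.

(* Main.v *)
Require Import Defs.
From HB Require Import structures.
From mathcomp Require Import all_boot all_order all_algebra.
From mathcomp Require Import sesquilinear.
From mathcomp Require Import all_classical all_reals all_analysis.
From mathcomp Require Import ring lra.

Set Implicit Arguments.
Unset Strict Implicit.
Unset Printing Implicit Defensive.

Import Order.TTheory GRing.Theory Num.Theory.
Import numFieldNormedType.Exports.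

Local Open Scope classical_set_scope.
Local Open Scope ring_scope.

(* Each minimization step says that a multiplier is a subgradient: lam_k is one
   of g at z_k (through B), and -mu_k, with
   mu_k = lam_k + rho^2 (A x_(k+1) - B z_k - c), is one of f at x_(k+1)
   (through A); the saddle point gives the same relations for lam* and -lam*.
   Monotonicity of subdifferentials then makes zeta_k |-> zeta_(k+1) firmly
   nonexpansive (it is the Douglas-Rachford operator), with fixed point
   zeta* = rho A x* + lam*/rho. Telescoping
   |zeta_(k+1) - zeta*|^2 + |zeta_(k+1) - zeta_k|^2 <= |zeta_k - zeta*|^2,
   whose second terms are nonincreasing, gives
   |zeta_(k+1) - zeta_k|^2 <= |zeta_0 - zeta*|^2 / (k+1), where zeta_0 = 0. The
   maps zeta_k |-> lam_k / rho and zeta_k |-> rho A x_(k+1) are nonexpansive. *)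

Section Inner.
Variables (R : realType) (K : hilbertType R).
Implicit Types u v w : K.

Lemma innerC u v : inner u v = inner v u.
Proof. by rewrite hermC/= expr0 mul1r. Qed.

Lemma innerDl u v w : inner (u + v) w = inner u w + inner v w.
Proof. exact: linearDl. Qed.

Lemma innerDr u v w : inner w (u + v) = inner w u + inner w v.
Proof. exact: linearDr. Qed.

Lemma innerZl (a : R) u v : inner (a *: u) v = a * inner u v.
Proof. exact: linearZl_LR. Qed.

Lemma innerZr (a : R) u v : inner u (a *: v) = a * inner u v.
Proof. by rewrite innerC innerZl innerC. Qed.

Lemma innerNl u v : inner (- u) v = - inner u v.
Proof. exact: linearNl. Qed.

Lemma innerNr u v : inner u (- v) = - inner u v.
Proof. exact: linearNr. Qed.

Definition innerE := (innerDl, innerDr, innerZl, innerZr, innerNl, innerNr).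

Lemma sqr_normD u v :
  `|u + v| ^+ 2 = `|u| ^+ 2 + 2 * inner u v + `|v| ^+ 2.
Proof. by rewrite !sqr_norm_inner !innerE (innerC v u); ring. Qed.

End Inner.

Section Subgradient.
Variables (R : realType) (X K : hilbertType R).
Implicit Types (F : X -> \bar R) (L : {linear X -> K}) (p q : X) (v w : K).

(* [v] is such that the adjoint image [L^* v] is a subgradient of [F] at [p] *)
Definition subgrad F L p v := F p \is a fin_num /\
  forall y, (F p + (inner v (L y - L p))%:E <= F y)%E.

(** Each subgradient inequality is tested at the other point; in their sum the finite values [F p]
    and [F q] cancel. *)
Lemma subgrad_monotone F L p q v w :
  subgrad F L p v -> subgrad F L q w -> 0 <= inner (v - w) (L p - L q).
Proof.
move=> [Fp subp] [Fq subq]; move: (subp q) (subq p).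
rewrite -(fineK Fp) -(fineK Fq) -!EFinD !lee_fin !innerE; lra.
Qed.

Lemma argmin_fin_num F (h : X -> R) p : proper_efun F ->
  argmin (fun y => F y + (h y)%:E)%E p -> F p \is a fin_num.
Proof.
move=> [FNy [y Fy]] /(_ y); move: (FNy p) (FNy y) Fy.
by case: (F p) => [r| |] //; case: (F y).
Qed.

(* First-order optimality, obtained by comparing [p] with the points
   [t *: y + (1 - t) *: p] as [t] tends to 0. *)
Lemma argmin_subgrad F L (phi : X -> K) (r : R) (b : K) p :
    convex_efun F -> proper_efun F ->
    (forall y, phi y = r *: L y + b) ->
    argmin (fun y => F y + (2^-1 * `|phi y| ^+ 2)%:E)%E p ->
  subgrad F L p (- r *: phi p).
Proof.
move=> cvxF propF phiE pmin; have Fp := argmin_fin_num propF pmin.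
split => // y; have [FNy _] := propF.
case Fy : (F y) => [s| |]; [|by rewrite leey|by have := FNy y; rewrite Fy].
move: cvxF pmin => /[swap] pmin /(_ _ y p).
have [m Fpm] : exists m, F p = m%:E by exists (fine (F p)); rewrite fineK.
rewrite Fpm Fy -EFinD lee_fin => cvxF.
set d := r *: (L y - L p); set D := `|d| ^+ 2; set a := inner (phi p) d.
have -> : inner (- r *: phi p) (L y - L p) = - a.
  by rewrite /a /d innerZl innerZr mulNr.
(* Minimality at the convex combination plus convexity, divided by [t]; the remainder [t * D / 2] is
   relaxed to [t * D]. *)
have small t : 0 < t < 1 -> 0 <= (s - m + a) + t * D.
  move=> t01; have := pmin (t *: y + (1 - t) *: p); rewrite Fpm.
  have -> : phi (t *: y + (1 - t) *: p) = phi p + t *: d.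
    have -> : t *: y + (1 - t) *: p = p + t *: (y - p).
      by rewrite scalerBl scale1r scalerBr addrCA.
    by rewrite !phiE linearD linearZ linearB scalerDr addrAC /d !scalerA mulrC.
  move: (cvxF t t01); case Fz : (F _) => [z| |] //.
  rewrite -!EFinM -!EFinD !lee_fin => convz.
  rewrite sqr_normD innerZr normrZ exprMn -/D -/a real_normK ?num_real//.
  have D0 : 0 <= D by exact: sqr_ge0.
  move: t01 => /andP[t0 t1] minz.
  rewrite -(pmulr_rge0 _ t0); have : 0 <= t * t * D by rewrite !mulr_ge0// ltW.
  rewrite expr2 in minz; lra.
have D0 : 0 <= D by exact: sqr_ge0.
rewrite leNgt; apply/negP => lt0.
set e := - (s - m + a); have e0 : 0 < e by rewrite /e; lra.
have De : 0 < D + 1 + e by lra.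
(* This [t] lies in (0, 1), even when [D = 0], and gives [t * D < e], contradicting [small]. *)
have := small (e / (D + 1 + e)).
rewrite divr_gt0//= ltr_pdivrMr// mul1r => /(_ _)/wrap[]; first lra.
have : e / (D + 1 + e) * D < e; last by rewrite /e; lra.
by rewrite mulrAC ltr_pdivrMr// ltr_pM2l//; lra.
Qed.

End Subgradient.

(* With [u] the difference of two fixed-point variables and [u'] that of their
   successors: firm nonexpansiveness of the iteration, and nonexpansiveness of
   the maps to [lam / rho] and to [rho A x]. *)
Lemma admm_step_contraction (R : realType) (K : hilbertType R) (rho : R)
    (a b l u u' : K) : rho != 0 ->
    u = rho *: b + rho^-1 *: l -> u' = rho *: a + rho^-1 *: l ->
    0 <= inner l b -> inner (l + rho ^+ 2 *: (a - b)) a <= 0 ->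
  [/\ `|u'| ^+ 2 + `|u' - u| ^+ 2 <= `|u| ^+ 2,
      `|l| ^+ 2 <= rho ^+ 2 * `|u| ^+ 2 &
      rho ^+ 2 * `|a| ^+ 2 <= `|u| ^+ 2].
Proof.
move=> rho0 -> -> lb la.
have rho2 : 0 <= rho ^+ 2 by exact: sqr_ge0.
have bb0 : 0 <= inner b b by rewrite -sqr_norm_inner sqr_ge0.
(* Slack for the third bound: [|u|^2 - rho^2 |a|^2] is this square plus multiples of the two sign
   hypotheses. *)
have := sqr_ge0 `|rho *: a - rho *: b + rho^-1 *: l|.
move: lb la; rewrite !sqr_norm_inner !innerE.
rewrite (innerC b l) (innerC a l) (innerC b a).
set ab := inner a b; set al := inner l a; set bl := inner l b.
set aa := inner a a; set bb := inner b b; set ll := inner l l.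
move=> lb la H; split.
- rewrite -subr_ge0; set X := (X in 0 <= X).
  have -> : X = 2 * bl - 2 * (al + rho ^+ 2 * (aa - ab)) by rewrite /X; field.
  lra.
- rewrite -subr_ge0; set X := (X in 0 <= X).
  have -> : X = rho ^+ 2 * (2 * bl + rho ^+ 2 * bb) by rewrite /X; field.
  by apply: mulr_ge0 => //; apply: addr_ge0; apply: mulr_ge0.
- rewrite -subr_ge0; set X := (X in 0 <= X); move: H; set Y := (X in 0 <= X).
  have -> : X = Y + 4 * bl - 2 * (al + rho ^+ 2 * (aa - ab)).
    by rewrite /X /Y; field.
  lra.
Qed.

Lemma fejer_rate (R : realType) (K : normedModType R) (u : nat -> K) (s : K) :
    (forall k, `|u k.+1 - s| ^+ 2 + `|u k.+1 - u k| ^+ 2 <= `|u k - s| ^+ 2) ->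
    (forall k, `|u k.+2 - u k.+1| ^+ 2 <= `|u k.+1 - u k| ^+ 2) ->
  forall k, `|u k.+1 - u k| ^+ 2 <= k.+1%:R^-1 * `|u 0%N - s| ^+ 2.
Proof.
move=> fejer decr k; rewrite mulrC ler_pdivlMr//.
(* Keeping the remaining distance to [s] makes the induction go through; as steps shrink, the last
   one can replace all earlier ones. *)
suff : `|u k.+1 - s| ^+ 2 + `|u k.+1 - u k| ^+ 2 * k.+1%:R <= `|u 0%N - s| ^+ 2.
  by apply: le_trans; rewrite lerDr sqr_ge0.
elim: k => [|k IHk]; first by rewrite mulr1.
apply: le_trans IHk; have := fejer k.+1.
have : `|u k.+2 - u k.+1| ^+ 2 * k.+1%:R <= `|u k.+1 - u k| ^+ 2 * k.+1%:R.
  by rewrite ler_wpM2r.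
by rewrite -[k.+2%:R]natr1; lra.
Qed.

(** The Lagrangian at the saddle point is at most its value at a pair where [f] and [g] are finite;
    properness excludes [-oo]. *)
Lemma saddle_fin_num (R : realType) (H P K : hilbertType R)
    (f : H -> \bar R) (g : P -> \bar R) (A : {linear H -> K})
    (B : {linear P -> K}) (c : K) (xs : H) (zs : P) (ls : K) :
    proper_efun f -> proper_efun g -> saddle_point f g A B c xs zs ls ->
  f xs \is a fin_num /\ g zs \is a fin_num.
Proof.
move=> [fNy [x fx]] [gNy [z gz]] /(_ x z ls)[_]; rewrite /lagrangian.
move: (fNy x) (fNy xs) (gNy z) (gNy zs) fx gz.
by case: (f x); case: (g z) => //; case: (f xs); case: (g zs).
Qed.

(** Only one primal variable is moved at a time, so the finite term of the other cancels. *)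
Lemma saddle_subgrad (R : realType) (H P K : hilbertType R)
    (f : H -> \bar R) (g : P -> \bar R) (A : {linear H -> K})
    (B : {linear P -> K}) (c : K) (xs : H) (zs : P) (ls : K) :
    proper_efun f -> proper_efun g -> saddle_point f g A B c xs zs ls ->
  subgrad f A xs (- ls) /\ subgrad g B zs ls.
Proof.
move=> propf propg sad; have [fxs gzs] := saddle_fin_num propf propg sad.
have [fNy _] := propf; have [gNy _] := propg.
split; split => // y.
- have [_] := sad y zs ls; rewrite /lagrangian.
  move: (fNy y); rewrite -(fineK fxs) -(fineK gzs).
  case: (f y) => [r| |] _ //; last by move=> _; rewrite leey.
  by rewrite -!EFinD !lee_fin !innerE; lra.
- have [_] := sad xs y ls; rewrite /lagrangian.
  move: (gNy y); rewrite -(fineK fxs) -(fineK gzs).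
  case: (g y) => [r| |] _ //; last by move=> _; rewrite leey.
  by rewrite -!EFinD !lee_fin !innerE; lra.
Qed.

Theorem proposition4p2 (R : realType) (H P K : hilbertType R)
  (f : H -> \bar R) (g : P -> \bar R)
  (A : {linear H -> K}) (B : {linear P -> K}) (c : K)
  (f_Gamma0 : Gamma0 f) (g_Gamma0 : Gamma0 g)
  (A_inj : injective A) (B_inj : injective B)
  (A_bounded : bounded_near A (nbhs (0 : H)))
  (B_bounded : bounded_near B (nbhs (0 : P)))
  (xs : H) (zs : P) (ls : K)
  (xs_zs_optimal : optimal_solution f g A B c xs zs)
  (ls_multiplier : saddle_point f g A B c xs zs ls)
  (rho : R) (rho_neq0 : rho != 0)
  (x : nat -> H) (z : nat -> P) (lam zeta : nat -> K)
  (iterates : admm_iterates f g A B c rho 0 x z lam zeta) :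
  (`|A xs| <> 0 -> `|ls| = 0 -> forall k : nat,
    [/\ `|A (x k.+2) - A (x k.+1)| ^+ 2 <= k.+1%:R^-1 * `|A xs| ^+ 2,
        `|lam k.+1 - lam k| ^+ 2 <= k.+1%:R^-1 * `|A xs| ^+ 2 * rho ^+ 4
      & `|zeta k.+1 - zeta k| ^+ 2 <= k.+1%:R^-1 * `|A xs| ^+ 2 * rho ^+ 2]) /\
  (`|A xs| = 0 -> `|ls| <> 0 -> forall k : nat,
    [/\ `|lam k.+1 - lam k| ^+ 2 <= k.+1%:R^-1 * `|ls| ^+ 2,
        `|A (x k.+2) - A (x k.+1)| ^+ 2 <=
          k.+1%:R^-1 * `|ls| ^+ 2 * (rho ^+ 4)^-1
      & `|zeta k.+1 - zeta k| ^+ 2 <=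
          k.+1%:R^-1 * `|ls| ^+ 2 * (rho ^+ 2)^-1]).
Proof.
have [cvxf _ propf] := f_Gamma0; have [cvxg _ propg] := g_Gamma0.
have [subfs subgs] := saddle_subgrad propf propg ls_multiplier.
case: iterates => zeta0E z0 lam0E xS zS lamS zetaS.
case: xs_zs_optimal => feas _.
(* The value that the constraint prescribes for [A x] when [z = z k]. *)
pose b k := B (z k) + c.
have scVK (v : K) : rho^-1 *: (rho *: v) = v by rewrite scalerA mulVf// scale1r.
(* Together with [zetaS], this writes [zeta k] and [zeta k.+1] through the same [lam k], as [u] and
   [u'] in [admm_step_contraction]. The initialization of [lam] covers [k = 0]. *)
have zetaE k : zeta k = rho *: b k + rho^-1 *: lam k.
  case: k => [|k].
    by rewrite zeta0E lam0E scaler0 sub0r expr2 -scalerA scalerN scVK subrr.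
  rewrite zetaS lamS -/(b _) -[A _ - _ - _]addrA -opprD -/(b _).
  rewrite [in RHS](scalerDr rho^-1) expr2 -scalerA scVK scalerBr addrCA.
  by rewrite [_ + (_ - _)]addrCA subrr addr0 addrC.
have subg k : subgrad g B (z k) (lam k).
  have lamE j : lam j = rho *: (zeta j - rho *: b j).
    by rewrite zetaE addrAC subrr add0r scalerA divff// scale1r.
  case: k => [|k].
    have /(argmin_subgrad cvxg propg) : forall y,
      rho *: B y + rho *: c - 0 = rho *: B y + rho *: c.
      by move=> y; rewrite subr0.
    move=> /(_ _ z0); rewrite lamE zeta0E.
    by rewrite subr0 -scalerDr scaleNr -scalerN sub0r.
  have /(argmin_subgrad cvxg propg) : forall y,
      rho *: (A (x k.+1) - B y - c) + rho^-1 *: lam k =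
      - rho *: B y + (rho *: (A (x k.+1) - c) + rho^-1 *: lam k).
    move=> y; rewrite addrA; congr +%R.
    by rewrite scaleNr -scalerN -scalerDr addrCA addrA.
  move=> /(_ _ (zS k)); rewrite opprK scalerDr !scalerA divff// scale1r lamS.
  by rewrite [lam k + _]addrC.
(* The multiplier update evaluated with the old [z k], since the x-step precedes the z-step. *)
pose mu k := lam k + rho ^+ 2 *: (A (x k.+1) - b k).
have subf k : subgrad f A (x k.+1) (- mu k).
  have /(argmin_subgrad cvxf propf) : forall y,
      rho *: (A y - B (z k) - c) + rho^-1 *: lam k =
      rho *: A y + (rho^-1 *: lam k - rho *: b k).
    by move=> y; rewrite -addrA -opprD scalerBr addrAC addrA.
  move=> /(_ _ (xS k)); rewrite scaleNr scalerDr !scalerA divff// scale1r.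
  by rewrite [_ + lam k]addrC -[A _ - _ - _]addrA -[- B _ - _]opprD.
have bBs k : b k - A xs = B (z k) - B zs.
  by rewrite /b -feas addrA addrAC addrK.
have bB j k : b j - b k = B (z j) - B (z k).
  by rewrite /b opprD addrACA subrr addr0.
clearbody b.
pose zetas := rho *: A xs + rho^-1 *: ls.
(* By feasibility [A xs] plays the part of both [A x] and [b] at the solution, so [zetas] is its own
   successor. *)
have contr_star k : `|zeta k.+1 - zetas| ^+ 2 + `|zeta k.+1 - zeta k| ^+ 2 <=
    `|zeta k - zetas| ^+ 2.
  have := @admm_step_contraction R K rho (A (x k.+1) - A xs) (b k - A xs)
    (lam k - ls) (zeta k - zetas) (zeta k.+1 - zetas) rho_neq0.
  case=> [|||//|].
  - by rewrite zetaE /zetas !scalerBr opprD addrACA.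
  - by rewrite zetaS /zetas !scalerBr opprD addrACA.
  - by rewrite bBs; exact: subgrad_monotone.
  - have := subgrad_monotone (subf k) subfs.
    rewrite -oppr_le0 -innerNl opprD !opprK /mu addrAC.
    by rewrite opprB addrA subrK.
  - by move=> + _ _; rewrite opprB addrA subrK.
have contr k : [/\ `|zeta k.+2 - zeta k.+1| ^+ 2 <= `|zeta k.+1 - zeta k| ^+ 2,
    `|lam k.+1 - lam k| ^+ 2 <= rho ^+ 2 * `|zeta k.+1 - zeta k| ^+ 2 &
    rho ^+ 2 * `|A (x k.+2) - A (x k.+1)| ^+ 2 <= `|zeta k.+1 - zeta k| ^+ 2].
  have := @admm_step_contraction R K rho (A (x k.+2) - A (x k.+1))
    (b k.+1 - b k) (lam k.+1 - lam k) (zeta k.+1 - zeta k)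
    (zeta k.+2 - zeta k.+1) rho_neq0.
  case=> [|||//|].
  - by rewrite !zetaE !scalerBr opprD addrACA.
  - by rewrite !zetaS !scalerBr opprD addrACA.
  - by rewrite bB; exact: subgrad_monotone.
  - have := subgrad_monotone (subf k.+1) (subf k).
    rewrite -oppr_le0 -innerNl opprD !opprK /mu.
    by rewrite opprD addrACA -scalerBr !opprD !opprK [X in _ *: X]addrACA.
  - by move=> H1 H2 H3; split => //; apply: le_trans H1; rewrite lerDl sqr_ge0.
have rate := fejer_rate contr_star (fun k => let: And3 H _ _ := contr k in H).
(* Starting at 0 makes the initial distance [|zetas|], of which each case keeps a single term. *)
have zeta0s : zeta 0%N - zetas = - zetas by rewrite zeta0E sub0r.
have rho2 : 0 < rho ^+ 2 by rewrite exprn_even_gt0.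
split=> [_ /normr0_eq0 ls0|/normr0_eq0 As0 _] k.
- have := rate k; rewrite zeta0s normrN /zetas ls0 scaler0 addr0 normrZ exprMn.
  rewrite real_normK ?num_real// => ratek; have [_ Hl Hx] := contr k.
  have ratek' : `|zeta k.+1 - zeta k| ^+ 2 <=
      k.+1%:R^-1 * `|A xs| ^+ 2 * rho ^+ 2.
    by rewrite mulrAC -mulrA.
  split=> //.
  + by rewrite -(ler_pM2r rho2) mulrC (le_trans Hx).
  + rewrite (le_trans Hl)// -[4%N]/(2 + 2)%N exprD [leRHS]mulrA mulrC.
    by rewrite ler_pM2r.
- have := rate k; rewrite zeta0s normrN /zetas As0 scaler0 add0r normrZ exprMn.
  rewrite real_normK ?num_real// exprVn => ratek; have [_ Hl Hx] := contr k.
  have ratek' : `|zeta k.+1 - zeta k| ^+ 2 <=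
      k.+1%:R^-1 * `|ls| ^+ 2 / rho ^+ 2.
    by rewrite mulrAC -mulrA.
  (* Passing from [zeta] to [lam] costs a factor [rho^2], which cancels here; passing to [A x]
     divides by [rho^2] once more. *)
  split=> //.
  + by rewrite (le_trans Hl)// mulrC -ler_pdivlMr.
  + rewrite -(ler_pM2l rho2) (le_trans Hx)// (le_trans ratek')//.
    rewrite -[4%N]/(2 + 2)%N exprD [leRHS]mulrC.
    rewrite [(rho ^+ 2 * _)^-1]invfM [leLHS]lock [_ * (_ / _)]mulrA.
    by rewrite mulfVK -?lock ?gt_eqF.
Qed.
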